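(* Let $A$ be a complex abelian variety with a faithful action of a finite cyclic group $G = \langle \alpha \rangle$ of order $d$. Let $W_1, \dots, W_r$ be the (pairwise non-isomorphic) irreducible rational representations of $G$, and let $$A_{W_1} \times \cdots \times A_{W_r} \stackrel{+}{\longrightarrow} A \qquad (\mathrm{I})$$ be the isotypical decomposition of $A$ with respect to $G$. Let $1 \le d_1 < d_2 < \cdots < d_s$ be the orders of the eigenvalues of the analytic representation $\rho_a(\alpha)$, and let $$B_{d_1} \times \cdots \times B_{d_s} \stackrel{+}{\longrightarrow} A \qquad (\mathrm{R})$$ be Roan's decomposition of $A$ with respect to $\alpha$ (both defined in the context). Then these two decompositions are the same in the following sense: (i) For every $i = 1, \dots, s$ there is exactly one $j_i \in \{1, \dots, r\}$ such that $$A_{W_{j_i}} = B_{d_i},$$ and the $j_i$'s are pairwise different. (ii) For all components $A_{W_k}$ with $k \neq j_i$ for $i = 1, \dots, s$ we have $A_{W_k} = 0$. So if one omits these components $A_{W_k}$, the isogenies (I) and (R) agree up to a permutation of the factors.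
   Context: Group actions on abelian varieties are by automorphisms (fixing $0$) and are assumed faithful. The analytic representation $\rho_a(\alpha)$ is the $\mathbb{C}$-linear map induced by $\alpha$ on the tangent space of $A$ at $0$. Since $\alpha$ has finite order, its eigenvalues (meaning the eigenvalues of $\rho_a(\alpha)$) are roots of unity; the order of an eigenvalue is its multiplicative order. Isotypical decomposition. The action induces a homomorphism of $\mathbb{Q}$-algebras $\rho : \mathbb{Q}[G] \to \mathrm{End}_{\mathbb{Q}}(A) = \mathrm{End}(A) \otimes_{\mathbb{Z}} \mathbb{Q}$. The semisimple algebra $\mathbb{Q}[G]$ is a product of simple $\mathbb{Q}$-algebras $Q_1 \times \cdots \times Q_r$, which gives a decomposition $1 = e_1 + \cdots + e_r$ into central idempotents $e_i$ ($e_i$ being the unit of $Q_i$). The $Q_i$, and hence the $e_i$, correspond bijectively to the irreducible rational representations $W_i$ of $G$. For an idempotent $e \in \mathbb{Q}[G]$, let $\mathrm{im}(e) \subseteq A$ be the abelian subvariety given by the image of $n\rho(e)$, where $n$ is any positive integer with $n\rho(e) \in \mathrm{End}(A)$; it does not depend on $n$. Put $A_{W_i} := \mathrm{im}(e_i)$. It is known that the addition map $A_{W_1} \times \cdots \times A_{W_r} \to A$ is an isogeny (the isotypical decomposition); some of the $A_{W_i}$ may be $0$. Roan's decomposition. Define $G$-stable abelian subvarieties of $A$ inductively by $$Y_{d_0} := A, \qquad Y_{d_i} := \mathrm{im}\big((1_A - \alpha^{d_i})|_{Y_{d_{i-1}}}\big) \quad \text{for } i = 1, \dots, s$$ (here $d_0$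 is only an index), and for $i = 1, \dots, s$ put $$B_{d_i} := \ker\big((1_A - \alpha^{d_i})|_{Y_{d_{i-1}}}\big)_0,$$ the connected component containing $0$ of the kernel. It is known (Roan's theorem) that the addition map $B_{d_1} \times \cdots \times B_{d_s} \to A$ is an isogeny and that the eigenvalues of $\alpha|_{B_{d_i}}$ are exactly the eigenvalues of $\alpha$ of order $d_i$. *)

(* Defs.v *)
From HB Require Import structures.
From mathcomp Require Import all_boot all_order all_algebra all_fingroup.
From mathcomp Require Import ring_quotient mxrepresentation sesquilinear.
From mathcomp Require Import complex.
From mathcomp Require Import all_classical reals topology.

Set Implicit Arguments.
Unset Strict Implicit.
Unset Printing Implicit Defensive.

Import Order.TTheory GRing.Theory Num.Theory.
Import numFieldTopology.Exports.

Local Open Scope classical_set_scope.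
Local Open Scope ring_scope.
Local Open Scope complex_scope.

(* The usual topology of the complex numbers, given by the modulus. *)
HB.instance Definition _ (R : realType) :=
  PseudoPointedMetric.copy R[i] R[i]^o.

Section Lattices.
Variables (R : realType) (g : nat) (L : zmodClosed 'rV[R[i]]_g).

(* L is the Z-span of an R-basis of C^g; the basis vectors are the rows of b *)
(* (the transpose of a period matrix).                                       *)
Definition is_lattice :=
  exists b : 'M[R[i]]_(2 * g, g),
    (forall v : 'rV[R[i]]_g,
       exists! c : 'rV[R]_(2 * g), v = map_mx (real_complex R) c *m b) /\
    (forall v : 'rV[R[i]]_g,
       v \in L <-> exists m : 'rV[int]_(2 * g), v = map_mx intr m *m b).

(* A polarization: a positive definite Hermitian form whose imaginary part   *)
(* is integral on L.                                                         *)
Definition polarizable :=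
  exists H : {dot 'rV[R[i]]_g for @Num.conj R[i]},
    forall u v, u \in L -> v \in L -> complex.Im (H u v) \is a Num.int.

End Lattices.

(* A complex abelian variety, as a polarizable complex torus C^g / L; its    *)
(* tangent space at 0 is 'rV[R[i]]_g.                                        *)
Record abelian_variety (R : realType) := AbelianVariety {
  av_dim : nat;
  av_lattice : zmodClosed 'rV[R[i]]_av_dim;
  av_latticeP : is_lattice av_lattice;
  av_polarizable : polarizable av_lattice
}.

(* The group C^g / L of points, with the quotient of the topology of C^g.    *)
Definition points (R : realType) (A : abelian_variety R) : Type :=
  quotient_topology (Quotient.quot (av_lattice A)).

HB.instance Definition _ (R : realType) (A : abelian_variety R) :=
  Topological.copy (points A) (quotient_topology (Quotient.quot (av_lattice A))).
HB.instance Definition _ (R : realType) (A : abelian_variety R) :=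
  GRing.Zmodule.copy (points A) (Quotient.quot (av_lattice A)).

Section AbelianVarieties.
Variables (R : realType) (A : abelian_variety R).
Local Notation g := (av_dim A).

Definition av_pi (v : 'rV[R[i]]_g) : points A :=
  (\pi_(Quotient.quot (av_lattice A)) v)%qT.

(* The homomorphisms of complex tori are the maps induced by the C-linear    *)
(* maps of tangent spaces preserving the lattices. The analytic              *)
(* representation of f is the (unique) linear map v |-> v *m rho_a f of the  *)
(* tangent space inducing f.                                                 *)
Record endo := Endo {
  endo_fun :> points A -> points A;
  rho_a : 'M[R[i]]_g;
  endoE : forall v, endo_fun (av_pi v) = av_pi (v *m rho_a)
}.

End AbelianVarieties.

Record faithful_action (R : realType) (A : abelian_variety R)
    (gT : finGroupType) (G : {group gT}) := FaithfulAction {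
  act_endo :> gT -> endo A;
  act_endo1 : act_endo 1%g =1 id;
  act_endoM : {in G &, forall x y,
    act_endo (x * y)%g =1 act_endo x \o act_endo y};
  act_endo_faithful : {in G, forall x, act_endo x =1 id -> x = 1%g}
}.

Section Isotypical.
Variables (R : realType) (A : abelian_variety R).
Variables (gT : finGroupType) (G : {group gT}) (rho : faithful_action A G).

(* MathComp identifies F[G] with the algebra of matrices spanned by the      *)
(* regular representation; the coefficient at x of the element e is then     *)
(* gring_row e 0 (gring_index G x). As rho_a is injective and additive,      *)
(* End_Q(A) is identified with the Q-span of rho_a(End(A)) in End_C(T_0 A).  *)
Definition rat_rho (e : 'M[rat]_#|G|) : 'M[R[i]]_(av_dim A) :=
  \sum_(x in G) ratr (gring_row e 0 (gring_index G x)) *: rho_a (rho x).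

Definition is_im (e : 'M[rat]_#|G|) (S : set (points A)) :=
  exists (n : nat) (f : endo A),
    [/\ (0 < n)%N, rho_a f = n%:R *: rat_rho e & S = range f].

(* is_im e S holds for exactly one S, which does not depend on n.            *)
Definition im (e : 'M[rat]_#|G|) : set (points A) := xget set0 (is_im e).

(* A value W of sG : irrType rat G is (the isomorphism class of) an          *)
(* irreducible rational representation of G, and Wedderburn_id W is the unit *)
(* of the corresponding simple factor of Q[G].                               *)
Definition isotypical (sG : irrType rat G) (W : sG) : set (points A) :=
  im (Wedderburn_id W).

End Isotypical.

Section Roan.
Variables (R : realType) (A : abelian_variety R) (alpha : endo A).

Definition one_sub_pow (m : nat) (x : points A) : points A :=
  x - iter m alpha x.

(* With ds = [:: d_1; ...; d_s] indexed from 0, roan_Y ds i is Y_{d_i} and   *)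
(* roan_B ds i is B_{d_(i+1)}.                                               *)
Fixpoint roan_Y (ds : seq nat) (i : nat) : set (points A) :=
  if i is i'.+1 then one_sub_pow (nth 0%N ds i') @` roan_Y ds i' else setT.

Definition roan_B (ds : seq nat) (i : nat) : set (points A) :=
  connected_component
    (roan_Y ds i `&` [set x | one_sub_pow (nth 0%N ds i) x = 0]) 0.

End Roan.

(* Main.v *)
From HB Require Import structures.
Require Import Defs.
From mathcomp Require Import all_boot all_order all_algebra all_fingroup.
From mathcomp Require Import mxrepresentation complex.
From mathcomp Require Import all_classical reals topology.
From mathcomp Require Import ring_quotient pgroup cyclic algC cyclotomic.
From mathcomp Require Import normed_module ring.

(* Write A = C^g / L, let M be the analytic representation of the generator  *)
(* and d the order of G, so that M^d = 1. Both decompositions are read off   *)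
(* the tangent space. A rational polynomial in M depends only on its values  *)
(* at the d-th roots of unity, and the unit of a simple factor of            *)
(* Q[G] = Q[X] / (X^d - 1) is the polynomial P_m equal to 1 at the roots of  *)
(* order m and to 0 at the others, for a single m dividing d: it is an       *)
(* idempotent, it generates a minimal ideal, and the roots of order m are    *)
(* conjugate over Q. So A_W is the image of V_m := im P_m(M), and V_m <> 0   *)
(* iff m is the order of an eigenvalue. As the d_i increase, d_i is the only *)
(* one of d_i, ..., d_s dividing d_i, so that 1 - M^(d_i) kills V_(d_i) and  *)
(* is invertible over Q[M] on the V_(d_j), j > i. Hence the kernel defining  *)
(* B_(d_i) is the image of V_(d_i) up to torsion translates, and its         *)
(* connected component is the image of V_(d_i) because L is discrete.        *)

Set Implicit Arguments.
Unset Strict Implicit.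
Unset Printing Implicit Defensive.

Import Order.TTheory GRing.Theory Num.Theory.
Import numFieldTopology.Exports.

Local Open Scope classical_set_scope.
Local Open Scope ring_scope.
Local Open Scope complex_scope.

(** * Discreteness of the lattice *)

(** Put V_m = im P_m(M) = ker (1 - P_m(M)). [Wedderburn_cyclic] matches the irreducible rational
    representations W with the divisors m = [k W] of d, and by [im_qeval] the isotypical component
    of W is the image of V_m in A. It is nonzero only if m is some d_i ([qeval_idem_neq0]).

    For m = d_i, the set whose component is B_(d_i) contains the image of V_m ([roan_poly_idem],
    [idem_one_sub_Xn]), and each of its points has a lift v with v (1 - P_m(M)) in n^-1 L for a
    fixed n ([roan_poly_one_sub_idem]). As n^-1 L is discrete, the component of 0 is the image of
    V_m ([connected_component_av_pi]). Identities between polynomials in M are checked at roots of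
    unity, by [qeval_eq] and [qeval_supported].

    The index of a component is unique because L contains no real line ([lattice_line]): V_m + L
    contains no nonzero V_m' with m' <> m. *)

Section Points.
Variables (R : realType) (A : abelian_variety R).
Local Notation g := (av_dim A).
Local Notation L := (av_lattice A).
Local Notation pi := (@av_pi R A).

Lemma av_pi_is_zmod_morphism : zmod_morphism pi.
Proof. exact: (raddfB (\pi_(Quotient.quot L)%qT)). Qed.

HB.instance Definition _ :=
  GRing.isZmodMorphism.Build _ _ pi av_pi_is_zmod_morphism.

Lemma av_pi_eq u v : (pi u = pi v) <-> u - v \in L.
Proof.
rewrite Quotient.idealrBE; split=> [uv|/eqP uv]; last exact: uv.
by apply/eqP; exact: uv.
Qed.

Lemma av_pi_surj x : exists v, pi v = x.
Proof.
by exists (generic_quotient.repr x); exact: generic_quotient.reprK.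
Qed.

Lemma av_pi_closed (F : set (points A)) : closed (pi @^-1` F) -> closed F.
Proof. by rewrite -!openC; exact. Qed.

Lemma av_pi_continuous : continuous pi.
Proof. exact: pi_continuous. Qed.

End Points.

Lemma norm_lt_ReIm (R : realType) (z : R[i]) (e : R) : `|z| < e%:C ->
  `|complex.Re z| < e /\ `|complex.Im z| < e.
Proof.
case: z => x y; rewrite normc_def ltcR /= => lt_e.
by split; apply: le_lt_trans lt_e;
  rewrite -sqrtr_sqr ler_sqrt ?lerDl ?lerDr ?addr_ge0 ?sqr_ge0.
Qed.

Section RealLinear.
Variables (R : realType) (g : nat) (phi : 'rV[R[i]]_g -> R).
Hypothesis phiD : forall u v, phi (u + v) = phi u + phi v.
Hypothesis phiZ : forall (t : R) v, phi (t%:C *: v) = t * phi v.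

Lemma real_linear_near v (e : R) : 0 < e ->
  \forall w \near v, `|phi w - phi v| < e.
Proof.
move=> e_gt0.
pose B := \sum_j (`|phi (delta_mx 0 j)| + `|phi ('i *: delta_mx 0 j)|) + 1.
have B_gt0 : 0 < B.
  by rewrite ltr_wpDl // sumr_ge0 // => j _; rewrite addr_ge0.
have phi0 : phi 0 = 0 by apply: (addrI (phi 0)); rewrite -phiD !addr0.
have phiB u w : phi (u - w) = phi u - phi w.
  by apply: (addIr (phi w)); rewrite -phiD !subrK.
have phiE u : phi u = \sum_j (complex.Re (u 0 j) * phi (delta_mx 0 j)
    + complex.Im (u 0 j) * phi ('i *: delta_mx 0 j)).
  rewrite [in LHS](row_sum_delta u) (big_morph phi phiD phi0).
  apply: eq_bigr => j _; rewrite -!phiZ -phiD scalerA -scalerDl.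
  by rewrite {1}[u 0 j]complexE mulrC.
near=> w.
have vw_e : ball v (e / B)%:C w.
  near: w; apply: nbhsx_ballx.
  by rewrite ltcR divr_gt0.
rewrite -phiB phiE (le_lt_trans (ler_norm_sum _ _ _)) //.
have -> : e = e / B * B by rewrite divfK ?gt_eqF.
rewrite mulrDr mulr1 ltr_pwDr ?divr_gt0 // mulr_sumr ler_sum // => j _.
have /norm_lt_ReIm[Re_le Im_le] : `|(w - v) 0 j| < (e / B)%:C.
  by rewrite !mxE distrC; exact: vw_e.2.
rewrite (le_trans (ler_normD _ _)) // !normrM mulrDr.
by apply: lerD; apply: ler_wpM2r => //; exact: ltW.
Unshelve. all: by end_near. Qed.

End RealLinear.

Section Lattice.
Variables (R : realType) (g : nat) (L : zmodClosed 'rV[R[i]]_g).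
Hypothesis latL : is_lattice L.

Lemma lattice_coord : exists c : 'rV[R[i]]_g -> 'rV[R]_(2 * g),
  [/\ forall u v, c (u + v) = c u + c v,
      forall (t : R) v, c (t%:C *: v) = t *: c v,
      forall v, c v = 0 -> v = 0 &
      forall v k, v \in L -> c v 0 k \is a Num.int].
Proof.
have [b [/= cE LE]] := latL.
have ex_c (v : 'rV[R[i]]_g) : exists c, v = map_mx (real_complex R) c *m b.
  by have [c []] := cE v; exists c.
have [c cP] := choice ex_c.
have c_inj (x y : 'rV[R]_(2 * g)) : map_mx (real_complex R) x *m b =
    map_mx (real_complex R) y *m b -> x = y.
  move=> xy; have [z [_ zP]] := cE (map_mx (real_complex R) x *m b).
  by rewrite -(zP x erefl) -(zP y xy).
exists c; split.
- by move=> u v; apply: c_inj; rewrite map_mxD mulmxDl -!cP.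
- by move=> t v; apply: c_inj; rewrite map_mxZ -scalemxAl -!cP.
- by move=> v cv; rewrite (cP v) cv map_mx0 mul0mx.
move=> v k /LE[m mE].
suff -> : c v = map_mx intr m by rewrite mxE rpred_int_num.
apply: c_inj; rewrite -cP mE -map_mx_comp; congr (_ *m _).
by apply/matrixP=> i j; rewrite !mxE /= rmorph_int.
Qed.

Lemma lattice_line v : (forall t : R, t%:C *: v \in L) -> v = 0.
Proof.
have [c [cD cZ c0 cL]] := lattice_coord => vL.
apply: c0; apply/rowP=> k; rewrite [RHS]mxE.
apply/eqP; apply: contraT => ck0.
(* This scalar makes the k-th coordinate 1/2, which is not an integer. *)
have := cL _ k (vL (c v 0 k *+ 2)^-1).
rewrite cZ mxE -mulr_natr invfM mulrAC mulVf // mul1r => /norm_intr_ge1.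
by rewrite invr_eq0 pnatr_eq0 normfV normr_nat invf_ge1 ?ltr0n // lern1 =>
  /(_ isT).
Qed.

Lemma int_isolated (r : R) :
  exists2 e : R, 0 < e & forall x, x \is a Num.int -> `|x - r| < e -> x = r.
Proof.
have [r_int|r_nint] := boolP (r \is a Num.int).
  exists 1 => // x x_int lt_xr1; apply/eqP; rewrite -subr_eq0.
  by apply: contraTT lt_xr1 => xr0; rewrite -leNgt norm_intr_ge1 // rpredB.
have lt_r : (Num.floor r)%:~R < r.
  by rewrite lt_neqAle -intrEfloor r_nint floor_le.
exists (Num.min (r - (Num.floor r)%:~R) ((Num.floor r + 1)%:~R - r)).
  by rewrite lt_min !subr_gt0 lt_r floorD1_gt.
move=> x /intrP[m ->]; rewrite lt_min => /andP[].
rewrite ltr_norml opprB => /andP[+ _]; rewrite ltrD2r ltr_int => lt_m.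
rewrite ltr_norml => /andP[_]; rewrite ltrD2r ltr_int ltzD1.
by rewrite leNgt lt_m.
Qed.

(* This is the discreteness of n^-1 L, pulled back by N.                      *)
Lemma closed_lattice (n : nat) (N : 'M[R[i]]_g) (F : set 'rV[R[i]]_g) :
    (0 < n)%N -> (forall v, F v -> n%:R *: v \in L) ->
  closed [set v : 'rV[R[i]]_g | F (v *m N)].
Proof.
have [c [cD cZ c0 cL]] := lattice_coord => n_gt0 FL.
have cB u v : c (u - v) = c u - c v.
  by apply: (addIr (c v)); rewrite -cD !subrK.
(* If F holds at w N, the coordinates [phi k w] of n w N are integers. For w near v they then equal
   those of n v N, so that w N = v N and F would hold at v N. *)
rewrite -openC openE => v /= Fv.
pose phi k (w : 'rV[R[i]]_g) := c (n%:R *: (w *m N)) 0 k.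
have near_phi k : \forall w \near v,
    phi k w \is a Num.int -> phi k w = phi k v.
  have [e e_gt0 eP] := int_isolated (phi k v).
  have phiD u w : phi k (u + w) = phi k u + phi k w.
    by rewrite /phi mulmxDl scalerDr cD mxE.
  have phiZ (t : R) w : phi k (t%:C *: w) = t * phi k w.
    by rewrite /phi -scalemxAl scalerA mulrC -scalerA cZ mxE.
  by apply: filterS (real_linear_near phiD phiZ v e_gt0) => w lt_we ?;
    apply: eP.
have FF : Filter (nbhs v) by exact: (@nbhs_filter _ v).
have near_all := @filter_forall _ _ _ (nbhs v) FF near_phi.
apply: (@filterS _ _ FF _ _ _ near_all) => w near_w Fw.
suff wv : w *m N = v *m N by rewrite /= wv in Fw.
have n_neq0 : n%:R != 0 :> R[i] by rewrite pnatr_eq0 -lt0n.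
apply: (scalerI n_neq0); apply/eqP; rewrite -subr_eq0; apply/eqP/c0.
rewrite cB; apply/rowP=> k; rewrite !mxE; apply/eqP; rewrite subr_eq0.
by apply/eqP/near_w/cL/FL.
Qed.
End Lattice.

Lemma real_line_continuous (R : realType) g (v : 'rV[R[i]]_g) :
  continuous (fun t : R => t%:C *: v).
Proof.
move=> t; apply/cvg_ballP => e e_gt0.
pose s j := Num.sqrt (complex.Re (v 0 j) ^+ 2 + complex.Im (v 0 j) ^+ 2).
pose B := \sum_j s j + 1.
have s_ge0 j : 0 <= s j by apply: sqrtr_ge0.
have B_gt0 : 0 < B by rewrite ltr_wpDl // sumr_ge0.
have eE : e = (complex.Re e)%:C.
  by case: e e_gt0 => x y; rewrite ltcE /= => /andP[/eqP-> _].
have Re_gt0 : 0 < complex.Re e by rewrite eE ltcR in e_gt0.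
near=> u; split=> // i j; rewrite ord1 !mxE /ball /= -mulrBl normrM -rmorphB.
have -> : `|v 0 j| = (s j)%:C by rewrite /s; case: (v 0 j).
rewrite normc_def /= expr0n addr0 sqrtr_sqr -rmorphM eE ltcR.
have le_sB : s j <= B by rewrite /B (bigD1 j) //= -addrA lerDl addr_ge0
  ?sumr_ge0.
have lt_tu : ball t (complex.Re e / B) u.
  by near: u; apply: (@nbhsx_ballx _ R t); rewrite divr_gt0.
rewrite (le_lt_trans (ler_wpM2l _ le_sB)) //.
by rewrite -ltr_pdivlMr.
Unshelve. all: by end_near. Qed.

(** * Connected components in the torus *)

Section Component.
Variables (R : realType) (A : abelian_variety R).
Local Notation g := (av_dim A).
Local Notation L := (av_lattice A).
Local Notation pi := (@av_pi R A).

(** The set is a union of images of real lines, all passing through 0. *)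
Lemma connected_av_pi (V : set 'rV[R[i]]_g) :
  (forall (t : R) v, V v -> V (t%:C *: v)) -> connected (pi @` V).
Proof.
move=> VZ.
have -> : pi @` V = \bigcup_(v in V) ((fun t : R => pi (t%:C *: v)) @` setT).
  apply/seteqP; split=> x.
    by move=> [v Vv <-]; exists v => //; exists 1 => //; rewrite scale1r.
  by move=> [v Vv [t _ <-]]; exists (t%:C *: v) => //; apply: VZ.
apply: bigcup_connected.
  by exists 0 => v Vv; exists 0 => //; rewrite scale0r raddf0.
move=> v Vv; apply: connected_continuous_connected.
  by apply/connected_intervalP => x y _ _ z.
apply: continuous_subspaceT => t;
  apply: (@continuous_comp _ _ _ (fun t : R => t%:C *: v) pi).
  exact: real_line_continuous.
exact: av_pi_continuous.
Qed.

(** S lies between the image of ker Q and the points having a lift v with v Q in the discrete group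
    n^-1 L; moving continuously from 0, v Q cannot leave L Q. *)
Lemma connected_component_av_pi (S : set (points A)) (Q : 'M[R[i]]_g) n :
    (0 < n)%N -> (forall v, v \in L -> n%:R *: (v *m Q) \in L) ->
    (forall v, v *m Q = 0 -> S (pi v)) ->
    (forall x, S x -> exists2 v, pi v = x & n%:R *: (v *m Q) \in L) ->
  connected_component S 0 = pi @` [set v | v *m Q = 0].
Proof.
move=> n_gt0 LQ QS SQ; apply/seteqP; split; last first.
  apply: connected_component_max.
  - by exists 0; rewrite /= ?mul0mx ?raddf0.
  - by move=> _ [v vQ <-]; apply: QS.
  apply: connected_av_pi => t v /=; rewrite -scalemxAl => ->; exact: scaler0.
(* The component K is contained in the union of two disjoint closed sets,    *)
(* according to whether v *m Q lies in L *m Q.                               *)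
set K := connected_component S 0.
pose F1 : set 'rV[R[i]]_g := [set u | exists2 l, l \in L & u = l *m Q].
pose F2 : set 'rV[R[i]]_g := [set u | n%:R *: u \in L /\ ~ F1 u].
have F1D u l : l \in L -> F1 (u + l *m Q) -> F1 u.
  move=> lL [l' l'L /(canRL (addrK _)) ->]; exists (l' - l);
    first exact: rpredB.
  by rewrite mulmxBl.
have F2D u l : l \in L -> F2 (u + l *m Q) -> F2 u.
  move=> lL [nu nF1]; split.
    by have := rpredB nu (LQ _ lL); rewrite scalerDr addrK.
  move=> F1u; apply: nF1; apply: (@F1D _ (- l)); rewrite ?rpredN //.
  by rewrite mulNmx addrK.
have closedF (F : set 'rV[R[i]]_g) : (forall u l, l \in L -> F (u + l *m Q) ->
  F u) ->
    (forall u, F u -> n%:R *: u \in L) -> closed (pi @` [set v | F (v *m Q)]).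
  move=> FD FL; apply: av_pi_closed.
  rewrite (_ : _ @^-1` _ = [set v | F (v *m Q)]).
    exact: closed_lattice (@av_latticeP _ A) _ _ _ n_gt0 FL.
  apply/seteqP; split=> [v /= [u Fu /av_pi_eq uvL]|v Fv]; last by exists v.
  by apply: (FD _ (u - v)) => //; rewrite -mulmxDl addrC subrK.
have F1L u : F1 u -> n%:R *: u \in L by move=> [l lL ->]; apply: LQ.
have cF1 := closedF F1 F1D F1L.
have cF2 := closedF F2 F2D (fun u => @proj1 _ _).
have K0 : K 0.
  apply: connected_component_refl; rewrite -(raddf0 pi).
  by apply: QS; rewrite mul0mx.
(* The part of K over [F1] contains 0, is closed, and is open in K as the complement of the part
   over [F2]. *)
have KF : K `&` pi @` [set v | F1 (v *m Q)] = K.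
  apply: (@component_connected _ S 0).
  - exists 0; split=> //; exists 0; rewrite /= ?raddf0 //.
    by exists 0; rewrite ?rpred0 ?mul0mx.
  - exists (~` (pi @` [set v | F2 (v *m Q)])); first by rewrite openC.
    apply/seteqP; split=> x [Kx].
      move: Kx => /[swap] -[v F1v <-] Kv;
        split=> // -[u [_ nF1] /av_pi_eq uvL]; apply: nF1.
      apply: (F1D _ (v - u)); first by rewrite -opprB rpredN.
      by rewrite -mulmxDl addrC subrK.
    move=> nF2; split=> //; have [v vx vQ] := SQ _ (@connected_component_sub _
      S 0 _ Kx).
    exists v => //; apply: contrapT => nF1; apply: nF2; exists v => //;
      split=> //.
  - by exists (pi @` [set v | F1 (v *m Q)]).
move=> x; rewrite -KF => -[_ [v [l lL vl] <-]]; exists (v - l).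
  by rewrite /= mulmxBl vl subrr.
by apply/av_pi_eq; rewrite addrC addKr rpredN.
Qed.
End Component.

(** * Rational polynomials in a matrix of finite order *)

Section RationalPolynomialsOfMatrices.
Variables (F : numFieldType) (n : nat) (M : 'M[F]_n).

(** The explicit sum makes sense for every size n, including 0. *)
Definition qeval (p : {poly rat}) : 'M[F]_n :=
  \sum_(i < size p) ratr p`_i *: M ^+ i.

Fact qeval_is_zmod_morphism : zmod_morphism qeval.
Proof.
have wide m (p : {poly rat}) : (size p <= m)%N ->
  qeval p = \sum_(i < m) ratr p`_i *: M ^+ i.
  move=> le_pm; rewrite /qeval (big_ord_widen _ (fun i =>
    ratr p`_i *: M ^+ i) le_pm).
  rewrite big_mkcond; apply: eq_bigr => i _; case: ltnP => // /leq_sizeP -> //.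
  by rewrite rmorph0 scale0r.
move=> p q; pose m := maxn (size p) (size q).
have le_pq : (size (p - q)%R <= m)%N by rewrite /m -(size_polyN q);
  apply: size_polyD.
rewrite (wide _ _ le_pq) (wide m p) ?leq_maxl // (wide m q) ?leq_maxr // -sumrB.
by apply: eq_bigr => i _; rewrite coefB rmorphB scalerBl.
Qed.

HB.instance Definition _ :=
  GRing.isZmodMorphism.Build _ _ qeval qeval_is_zmod_morphism.

Lemma qevalZXn a i : qeval (a *: 'X^i) = ratr a *: M ^+ i.
Proof.
have [->|a0] := eqVneq a 0; first by rewrite scale0r raddf0 rmorph0 scale0r.
rewrite /qeval size_scale // size_polyXn (bigD1 ord_max) //= big1 ?addr0 =>
  [|j].
  by rewrite coefZ coefXn eqxx mulr1.
rewrite -val_eqE /= => /negbTE ne_ji; rewrite coefZ coefXn ne_ji mulr0.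
by rewrite rmorph0 scale0r.
Qed.

Fact qeval_is_monoid_morphism : monoid_morphism qeval.
Proof.
split=> [|p q]; first by rewrite -[1]scale1r -(expr0 'X) qevalZXn rmorph1
  scale1r.
rewrite -[p]coefK -[q]coefK !poly_def mulr_suml !raddf_sum mulr_suml.
apply: eq_bigr => i _; rewrite !mulr_sumr raddf_sum; apply: eq_bigr => j _ /=.
rewrite -scalerAl -scalerAr scalerA -exprD !qevalZXn rmorphM exprD.
by rewrite -[RHS]/(_ *m _) -scalemxAl -scalemxAr scalerA.
Qed.

HB.instance Definition _ :=
  GRing.isMonoidMorphism.Build _ _ qeval qeval_is_monoid_morphism.

Lemma qevalM p q : qeval (p * q) = qeval p *m qeval q.
Proof. exact: rmorphM. Qed.

Lemma qevalZ a p : qeval (a *: p) = ratr a *: qeval p.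
Proof.
have -> : a *: p = a *: 'X^0 * p by rewrite expr0 -scalerAl mul1r.
rewrite rmorphM /= qevalZXn expr0 -[LHS]/(_ *m _) -scalemxAl.
by congr (_ *: _); exact: mul1mx.
Qed.

Lemma qevalX : qeval 'X = M.
Proof. by rewrite -['X]scale1r -(expr1 'X) qevalZXn rmorph1 scale1r. Qed.

Lemma qevalXn i : qeval 'X^i = M ^+ i.
Proof. by rewrite rmorphXn /= qevalX. Qed.

End RationalPolynomialsOfMatrices.

Section RootsOfUnity.
Variable d : nat.
Hypothesis d_gt0 : (0 < d)%N.
Local Notation pQ := (map_poly (ratr : rat -> algC)).

(** Over algC, X^d - 1 is a product of d distinct linear factors, and divisibility of rational
    polynomials can be tested there. *)
Lemma dvdp_Xn_sub1 (p : {poly rat}) :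
  (forall w : algC, w ^+ d = 1 -> (pQ p).[w] = 0) -> 'X^d - 1 %| p.
Proof.
move=> p0; have [z z_prim] := C_prim_root_exists d_gt0.
rewrite -(dvdp_map (ratr : {rmorphism rat ->
  algC})) rmorphB rmorph1 /= map_polyXn.
rewrite -(factor_Xn_sub_1 z_prim) -(big_map (fun i => z ^+ i) xpredT (fun x =>
  'X - x%:P)).
apply: uniq_roots_dvdp.
  apply/allP=> _ /mapP[i _ ->]; rewrite /root p0 //.
  by rewrite exprAC (prim_expr_order z_prim) expr1n.
rewrite uniq_rootsE map_inj_in_uniq ?iota_uniq // => i j.
rewrite !mem_index_iota => /= lt_id lt_jd /eqP.
by rewrite (eq_prim_root_expr z_prim) !modn_small // => /eqP.
Qed.

(** The difference p - q is a multiple of X^d - 1, which kills M. The roots of unity live in algC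
    whatever [F] is: only rational polynomials link the two. *)
Lemma qeval_eq (F : numFieldType) n (M : 'M[F]_n) (p q : {poly rat}) :
    M ^+ d = 1 ->
    (forall w : algC, w ^+ d = 1 -> (pQ p).[w] = (pQ q).[w]) ->
  qeval M p = qeval M q.
Proof.
move=> Md1 pq; apply/eqP; rewrite -subr_eq0 -raddfB /=.
have /dvdpP[r ->] : 'X^d - 1 %| p - q.
  by apply: dvdp_Xn_sub1 => w wd1; rewrite raddfB hornerD hornerN pq // subrr.
by rewrite rmorphM rmorphB rmorph1 /= qevalXn Md1 subrr mulr0.
Qed.

(** Both roots have the same minimal polynomial over Q, the cyclotomic one. *)
Lemma prim_root_rat_root k (w w' : algC) (p : {poly rat}) :
  k.-primitive_root w -> k.-primitive_root w' -> (pQ p).[w] = 0 ->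
    (pQ p).[w'] = 0.
Proof.
move=> w_prim w'_prim /eqP pw.
have [q [Dq _] qw] := minCpolyP w.
have: root (pQ q) w'.
  rewrite -Dq (minCpoly_cyclotomic w_prim) -(Cintr_Cyclotomic w_prim).
  rewrite (Cintr_Cyclotomic w'_prim) -(minCpoly_cyclotomic w'_prim).
  exact: root_minCpoly.
have /dvdpP[r ->] : q %| p by rewrite -qw; exact: pw.
by rewrite rmorphM hornerM => /rootP->; rewrite mulr0.
Qed.

Lemma prim_root_unique m k (w : algC) :
  m.-primitive_root w -> k.-primitive_root w -> m = k.
Proof.
move=> mw kw; apply/eqP; rewrite eqn_dvd (prim_order_dvd mw) (prim_order_dvd
  kw).
by rewrite !prim_expr_order ?eqxx.
Qed.
End RootsOfUnity.

(** * Wedderburn components of the rational group ring of a cyclic group *)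

Section CyclicWedderburn.
Local Notation pQ := (map_poly (ratr : rat -> algC)).
Variables (gT : finGroupType) (G : {group gT}) (a : gT).
Hypothesis hG : G :=: <[a]>%g.
Local Notation Rm := (regular_repr rat G a).
Local Notation R_G := (group_ring rat G).
Let Ga : a \in G. Proof. by rewrite hG cycle_id. Qed.
Let a_order : #[a]%g = #|G|. Proof. by rewrite /order -hG. Qed.
Let d_gt0 : (0 < #|G|)%N. Proof. exact: cardG_gt0. Qed.

Lemma regular_cyclicX i : regular_repr rat G (a ^+ i)%g = Rm ^+ i.
Proof.
elim: i => [|i IHi]; first by rewrite expg0 expr0 repr_mx1.
by rewrite expgS exprS repr_mxM ?groupX // IHi.
Qed.

Lemma regular_cyclic_order : Rm ^+ #|G| = 1.
Proof. by rewrite -regular_cyclicX -a_order expg_order repr_mx1. Qed.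

Lemma group_ring_cyclicP e :
  reflect (exists p, e = qeval Rm p) (e \in R_G)%MS.
Proof.
apply: (iffP idP) => [/envelop_mxP[c ->]|[p ->]].
  elim/big_ind: _ => [|_ _ [p ->] [q ->]|x].
  - by exists 0; rewrite raddf0.
  - by exists (p + q); rewrite raddfD.
  rewrite {1}hG => /cycleP[i ->]; exists (c (a ^+ i)%g *: 'X^i).
  by rewrite qevalZXn regular_cyclicX -(fmorph_eq_rat idfun).
rewrite /qeval raddf_sum summx_sub // => i _ /=.
by rewrite linearZ scalemx_sub //= -regular_cyclicX envelop_mx_id ?groupX.
Qed.

(** A converse of [qeval_eq]: the regular matrices of the elements of G are linearly independent, so
    p is 0 modulo X^#|G| - 1. *)
Lemma qeval_regular_eq0 p w : qeval Rm p = 0 -> w ^+ #|G| = 1 -> (pQ p).[w] = 0.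
Proof.
move=> p0 wd1; pose r := p %% ('X^#|G| - 1).
have p_eq : p = p %/ ('X^#|G| - 1) * ('X^#|G| - 1) + r by exact: divp_eq.
suff r0 : r = 0.
  rewrite p_eq r0 addr0 rmorphM rmorphB rmorph1 /= map_polyXn.
  by rewrite !hornerE wd1 subrr mulr0.
have : qeval Rm r = 0.
  move: p0; rewrite {1}p_eq raddfD /= rmorphM rmorphB rmorph1 /= qevalXn.
  by rewrite regular_cyclic_order subrr mulr0 add0r.
have le_r : (size r <= #|G|)%N.
  by rewrite -ltnS -(size_Xn_sub_1 rat d_gt0) ltn_modp -size_poly_gt0
    size_Xn_sub_1.
move=> qr0; apply/polyP=> j; rewrite coef0.
have [lt_j|] := ltnP j #|G|; last by move/(leq_trans le_r)/leq_sizeP->.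
have := congr1 (@gring_proj _ _ G (a ^+ j)%g) qr0;
  rewrite /qeval !linear_sum /= linear0.
have [/leq_sizeP-> //|lt_jr] := leqP (size r) j.
rewrite (bigD1 (Ordinal lt_jr)) //= big1 => [|i ne_ij].
  rewrite addr0 linearZ /= -regular_cyclicX gring_projE ?groupX // eqxx.
  by move/eqP; rewrite scaler_eq0 oner_eq0 orbF fmorph_eq0 => /eqP.
rewrite linearZ /= -regular_cyclicX gring_projE ?groupX // eq_expg_mod_order.
rewrite a_order !modn_small ?(leq_trans (ltn_ord i)) //.
by move: ne_ij; rewrite -val_eqE /= eq_sym => /negbTE->; rewrite scaler0.
Qed.

Section Wedderburn.
Variable sG : irrType rat G.
Local Notation e := (@Wedderburn_id _ _ _ sG).
Local Notation R_ := (@Wedderburn_subring _ _ _ sG).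

Let ratG : ([pchar rat]^'.-group G)%g.
Proof. by apply/pgroupP=> p _ _; rewrite inE /= pchar_num. Qed.

Lemma Wedderburn_sub W : (R_ W <= R_G)%MS.
Proof. by rewrite -(Wedderburn_sum_pchar sG ratG) (sumsmx_sup W). Qed.

Lemma Wedderburn_id_qeval W : exists p, e W = qeval Rm p.
Proof.
exact/group_ring_cyclicP/(memmx_subP (Wedderburn_sub W))/Wedderburn_id_mem.
Qed.

(* The ideal of R_G generated by q(Rm) e_W is 0 or the whole factor of e_W.  *)
Lemma Wedderburn_qeval_split W q :
  qeval Rm q *m e W = 0 \/ exists r, e W = qeval Rm q *m e W *m qeval Rm r.
Proof.
have [p ep] := Wedderburn_id_qeval W.
set B := qeval Rm q *m e W.
have [->|B_neq0] := eqVneq B 0; [by left | right].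
(* The ideal B R_G, with matrices flattened to row vectors. *)
pose E := R_G *m lin_mx (mulmx B).
have memE C : reflect (exists r, C = B *m qeval Rm r) (C \in E)%MS.
  apply: (iffP submxP) => [[y Cy]|[r ->]].
    have /group_ring_cyclicP[r rE] : (vec_mx (y *m R_G) \in R_G)%MS.
      by rewrite vec_mxK submxMl.
    exists r; apply: (can_inj mxvecK).
    by rewrite -rE -mul_vec_lin vec_mxK Cy mulmxA.
  have /submxP[y yE] : (qeval Rm r \in R_G)%MS by apply/group_ring_cyclicP;
    exists r.
  by exists y; rewrite mulmxA -yE mul_vec_lin.
have BE : B = qeval Rm (q * p) by rewrite /B ep qevalM.
have [idlR idrR] := andP (Wedderburn_ideal W).
have BR : (B \in R_ W)%MS.
  apply: (mulsmx_subP idlR); last exact: Wedderburn_id_mem.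
  by apply/group_ring_cyclicP; exists q.
have EB : (B \in E)%MS by apply/memE; exists 1; rewrite rmorph1 [RHS]mulmx1.
have sER : (E <= R_ W)%MS.
  apply/memmx_subP=> C /memE[r ->]; apply: (mulsmx_subP idrR) => //.
  by apply/group_ring_cyclicP; exists r.
have E_neq0 : E != 0.
  apply: contraNneq B_neq0 => E0; case/submxP: EB => y.
  by rewrite E0 mulmx0 => /eqP; rewrite mxvec_eq0.
have idE : mx_ideal R_G E.
  apply/andP; split; apply/mulsmx_subP=> C D.
    move=> /group_ring_cyclicP[r ->] /memE[r' ->]; apply/memE; exists (r * r').
    by rewrite BE -!qevalM mulrCA.
  move=> /memE[r' ->] /group_ring_cyclicP[r ->]; apply/memE; exists (r' * r).
  by rewrite qevalM mulmxA.
have RE := Wedderburn_min_ideal_pchar ratG E_neq0 sER idE.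
by have /memE : (e W \in E)%MS by rewrite RE; exact: Wedderburn_id_mem.
Qed.

(** Units of different factors are orthogonal, which makes [k] injective; all the units add up to 1,
    so for each divisor m of #|G| some unit is nonzero at the roots of order m. *)
Lemma Wedderburn_cyclic : exists (k : sG -> nat) (P : sG -> {poly rat}),
  [/\ forall W, e W = qeval Rm (P W),
      forall W w, w ^+ #|G| = 1 ->
        (pQ (P W)).[w] = ((k W).-primitive_root w)%:R,
      injective k,
      forall W, (k W %| #|G|)%N &
      forall m, (m %| #|G|)%N -> exists W, k W = m].
Proof.
have [P eP] : exists P : sG -> {poly rat}, forall W, e W = qeval Rm (P W).
  by have [P] := boolp.choice Wedderburn_id_qeval; exists P.
have val_eq p q w : qeval Rm p = qeval Rm q -> w ^+ #|G| = 1 ->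
  (pQ p).[w] = (pQ q).[w].
  move=> pq wd1; apply/eqP; rewrite -subr_eq0 -hornerN -hornerD -raddfB.
  by rewrite qeval_regular_eq0 // raddfB /= pq subrr.
have val01 W w : w ^+ #|G| = 1 -> (pQ (P W)).[w] != 0 -> (pQ (P W)).[w] = 1.
  move=> wd1 Pw; apply: (mulfI Pw); rewrite mulr1 -hornerM -rmorphM /=.
  apply: val_eq wd1; rewrite qevalM -eP.
  by have [_ _ ideR _] := Wedderburn_is_id_pchar ratG W; apply: ideR;
    apply: Wedderburn_id_mem.
(* If w'^k <> 1, then X^k - 1 vanishes at w but not at w', so multiplying    *)
(* e W by it gives a nonzero proper ideal.                                   *)
have val_min W w w' k k' : w ^+ #|G| = 1 -> w' ^+ #|G| = 1 ->
  k.-primitive_root w ->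
    k'.-primitive_root w' -> (pQ (P W)).[w] != 0 -> (pQ (P W)).[w'] != 0 ->
      (k' %| k)%N.
  move=> wd1 w'd1 kw kw' Pw Pw'; rewrite (prim_order_dvd kw').
  have hornerX1 x : (pQ ('X^k - 1)).[x] = x ^+ k - 1.
    by rewrite rmorphB rmorph1 /= map_polyXn !hornerE.
  have [] := Wedderburn_qeval_split W ('X^k - 1); rewrite eP.
    rewrite -qevalM -(raddf0 (qeval Rm)) => /val_eq/(_ w'd1).
    rewrite rmorphM raddf0 hornerM horner0 hornerX1 => /eqP.
    by rewrite mulf_eq0 (negbTE Pw') orbF subr_eq0.
  move=> [r]; rewrite -!qevalM => /val_eq/(_ wd1).
  rewrite !rmorphM !hornerM hornerX1 (prim_expr_order kw) subrr !mul0r.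
  by move=> Pw0; rewrite Pw0 eqxx in Pw.
have ex_k W : exists k, exists w, [/\ w ^+ #|G| =
  1, k.-primitive_root w & (pQ (P W)).[w] != 0].
  have [e_neq0 _ _ _] := Wedderburn_is_id_pchar ratG W.
  apply: contrapT => no_k; move/eqP: e_neq0; apply.
  rewrite eP -(raddf0 (qeval Rm));
    apply: (qeval_eq d_gt0 regular_cyclic_order) => w wd1.
  rewrite raddf0 horner0; apply/eqP; apply: contrapT => /negP Pw; apply: no_k.
  by have [k kw _] := prim_order_exists d_gt0 wd1; exists k, w.
have [k kP] := choice ex_k.
have k_dvd W : (k W %| #|G|)%N.
  by have [w [wd1 kw _]] := kP W; rewrite (prim_order_dvd kw) wd1.
have kE W w : w ^+ #|G| = 1 -> (pQ (P W)).[w] != 0 -> (k W).-primitive_root w.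
  move=> wd1 Pw; have [w' [w'd1 kw' Pw']] := kP W.
  have [m mw _] := prim_order_exists d_gt0 wd1.
  suff -> : k W = m by [].
  by apply/eqP; rewrite eqn_dvd (@val_min W w w' m) // (@val_min W w' w (k W)).
(* Being nonzero at one root of order [k W], [P W] is nonzero at all of them by conjugacy. *)
have PE W w : w ^+ #|G| = 1 -> (pQ (P W)).[w] = ((k W).-primitive_root w)%:R.
  move=> wd1; have [kw|not_kw] := boolP (_.-primitive_root w).
    apply: val01 => //; have [w' [w'd1 kw' Pw']] := kP W.
    by apply: contraNneq Pw' => Pw; apply/eqP/(prim_root_rat_root kw kw' Pw).
  by apply/eqP; apply: contraNT not_kw; exact: kE.
exists k, P; split=> // [W W' kWW'|m m_dvd].
  apply/eqP; apply: contraT => neWW'.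
  have [w [wd1 kw _]] := kP W.
  have := Wedderburn_mulmx0 neWW' (Wedderburn_id_mem W) (Wedderburn_id_mem W').
  rewrite !eP -qevalM -(raddf0 (qeval Rm)) => /val_eq/(_ wd1).
  rewrite rmorphM raddf0 hornerM horner0 !PE // -kWW' kw mulr1 => /eqP.
  by rewrite oner_eq0.
have m_gt0 := dvdn_gt0 d_gt0 m_dvd.
have [w mw] := C_prim_root_exists m_gt0.
have wd1 : w ^+ #|G| = 1 by apply/eqP; rewrite -(prim_order_dvd mw).
have := Wedderburn_sum_id_pchar sG ratG.
rewrite (eq_bigr (fun W => qeval Rm (P W))) => [|W _]; last exact: eP.
rewrite -raddf_sum -[1%:M](rmorph1 (qeval Rm)) => /val_eq/(_ wd1).
rewrite raddf_sum rmorph1 hornerC horner_sum => sum1.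
have [W Pw] : exists W, (pQ (P W)).[w] != 0.
  apply: contrapT => no_W; move/eqP: sum1;
    rewrite big1 ?(eq_sym 0) ?oner_eq0 // => W _.
  by apply/eqP; apply: contrapT => /negP Pw; apply: no_W; exists W.
by exists W; apply: (prim_root_unique _ mw); exact: kE.
Qed.
End Wedderburn.
End CyclicWedderburn.

(** * The eigenspace decomposition *)

Lemma one_sub_sum_natr (F : numFieldType) (u : F) n :
  (1 - u) * (\sum_(j < n) j%:R * u ^+ j) =
    \sum_(j < n) u ^+ j.+1 - n%:R * u ^+ n.
Proof.
elim: n => [|n IHn]; first by rewrite !big_ord0 mulr0 mul0r subrr.
by rewrite !big_ord_recr /= mulrDr IHn -natr1 exprS; ring.
Qed.

Lemma horner_one_sub_Xn (F : numFieldType) m (w : F) :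
  (map_poly ratr (1 - 'X^m)).[w] = 1 - w ^+ m.
Proof. by rewrite rmorphB rmorph1 /= map_polyXn !hornerE. Qed.

(* If u^d = 1 and u <> 1, then 1 / (1 - u) = - (1 / d) sum_(j < d) j u^j.    *)
Definition inv_one_sub_Xn (d m : nat) : {poly rat} :=
  - d%:R^-1 *: \sum_(j < d) j%:R *: 'X^(m * j).

(** The inverse of 1 - w^m is given by a rational polynomial so that, evaluated at M, it maps L into
    some n^-1 L. *)
Lemma inv_one_sub_XnP (F : numFieldType) d m (w : F) : (0 < d)%N ->
  w ^+ d = 1 ->
  (map_poly ratr (inv_one_sub_Xn d m)).[w] * (1 - w ^+ m) = (w ^+ m != 1)%:R.
Proof.
move=> d_gt0 wd1; have [->|wm1] := eqVneq (w ^+ m) 1;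
  first by rewrite subrr mulr0.
have wmd1 : (w ^+ m) ^+ d = 1 by rewrite exprAC wd1 expr1n.
rewrite map_polyZ hornerZ rmorph_sum horner_sum /= rmorphN fmorphV rmorph_nat.
rewrite (eq_bigr (fun j : 'I_d => j%:R * (w ^+ m) ^+ j)) => [|j _]; last first.
  by rewrite map_polyZ map_polyXn hornerZ hornerXn rmorph_nat exprM.
rewrite -mulrA (mulrC (\sum_(j < d) _)) one_sub_sum_natr wmd1 mulr1.
rewrite (eq_bigr (fun j : 'I_d => w ^+ m * (w ^+ m) ^+ j)) => [|j _];
  last by rewrite exprS.
rewrite -mulr_sumr.
have -> : \sum_(j < d) (w ^+ m) ^+ j = 0.
  by apply/eqP; have := subrX1 (w ^+ m) d; rewrite wmd1 subrr => /esym/eqP;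
    rewrite mulf_eq0 subr_eq0 (negbTE wm1).
by rewrite mulr0 sub0r mulrNN mulVf // pnatr_eq0 -lt0n.
Qed.

(** The linear factors M - r of M^d - 1 = 0 are applied to u until the next one would give 0; [B] is
    the product of those applied. *)
Lemma finite_order_eigenvector (C : numClosedFieldType) n (M : 'M[C]_n) d (u :
  'rV_n) :
    (0 < d)%N -> M ^+ d = 1 -> u != 0 -> exists B r,
  [/\ B *m M = M *m B, u *m B != 0 & u *m B *m M = r *: (u *m B)].
Proof.
move=> d_gt0; case: n M u => [|n] M u Md1; first by rewrite thinmx0 eqxx.
have [s Ds] := closed_field_poly_normal ('X^d - 1 : {poly C}).
have : u *m horner_mx M (\prod_(r <- s) ('X - r%:P)) = 0.
  move: Ds; rewrite (monicP (monic_Xn_sub_1 _ d_gt0)) scale1r => <-.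
  by rewrite rmorphB rmorphXn rmorph1 /= horner_mx_X Md1 subrr mulmx0.
elim: s u {Ds} => [|r s IHs] u us0 u_neq0.
  by rewrite big_nil rmorph1 mulmx1 in us0; rewrite us0 eqxx in u_neq0.
have [ur0|ur_neq0] := eqVneq (u *m (M - r%:M)) 0.
  exists 1%:M, r; rewrite mulmx1 mul1mx mulmx1; split=> //.
  by apply/eqP; rewrite -subr_eq0 -mul_mx_scalar -mulmxBr ur0.
rewrite big_cons rmorphM rmorphB /= horner_mx_X horner_mx_C -mulmxE mulmxA in
  us0.
have [B [r' [BM uB uBM]]] := IHs _ us0 ur_neq0.
exists ((M - r%:M) *m B), r'; rewrite (mulmxA u); split=> //.
rewrite -mulmxA BM !mulmxA mulmxBl mulmxBr.
by rewrite mul_scalar_mx mul_mx_scalar.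
Qed.

(** * Endomorphisms and their denominators *)

Section LatticeEndo.
Variables (R : realType) (A : abelian_variety R).
Local Notation g := (av_dim A).
Local Notation L := (av_lattice A).
Local Notation pi := (@av_pi R A).
Local Notation C := (R[i]).

Lemma av_pi_eq0 v : pi v = 0 <-> v \in L.
Proof. by rewrite -(raddf0 pi) av_pi_eq subr0. Qed.

Lemma rho_a_lattice (f : endo A) v : v \in L -> v *m rho_a f \in L.
Proof. by move=> /av_pi_eq0 v0; apply/av_pi_eq0;
  rewrite -endoE v0 -(raddf0 pi) endoE mul0mx. Qed.

(** The difference of the matrices maps the real line through each basis vector into L, hence to
    0. *)
Lemma av_pi_mx_inj (N1 N2 : 'M[C]_g) : (forall v, pi (v *m N1) =
  pi (v *m N2)) -> N1 = N2.
Proof.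
move=> piN; apply/row_matrixP=> i; apply/eqP; rewrite -subr_eq0; apply/eqP.
apply: (lattice_line (@av_latticeP _ A)) => t.
by rewrite !rowE -mulmxBr scalemxAl mulmxBr; apply/av_pi_eq.
Qed.

Lemma endo_of_mx (N : 'M[C]_g) : (forall v, v \in L -> v *m N \in L) ->
  exists f : endo A, rho_a f = N.
Proof.
move=> NL; pose f (x : points A) := pi (generic_quotient.repr x *m N).
have fE v : f (pi v) = pi (v *m N).
  apply/av_pi_eq; rewrite -mulmxBl; apply: NL; apply/av_pi_eq.
  exact: generic_quotient.reprK.
by exists (Endo fE).
Qed.

Lemma qeval_denominator (M : 'M[C]_g) (p : {poly rat}) :
    (forall v, v \in L -> v *m M \in L) ->
  exists2 n, (0 < n)%N & forall v, v \in L -> n%:R *: (v *m qeval M p) \in L.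
Proof.
move=> ML; have [q [b b_neq0 ->]] := rat_poly_scale p.
exists `|b|%N; first by rewrite absz_gt0.
move=> v vL; rewrite qevalZ -scalemxAr scalerA.
(* b is a common denominator of p, and |b| / b is its sign. *)
have -> : `|b|%N%:R * ratr (b%:~R^-1) = (Num.sg b)%:~R :> C.
  rewrite fmorphV rmorph_int /= [_%:R]pmulrn abszE normrEsg.
  by rewrite rmorphM /= mulfK ?intr_eq0.
rewrite scaler_int rpredMz // /qeval mulmx_sumr rpred_sum // => i _.
rewrite coef_map /= rmorph_int -scalemxAr scaler_int rpredMz //.
by elim: (i : nat) v vL => [|j IHj] v vL;
  rewrite ?mulmx1 // exprS [_ * _]/(_ *m _) mulmxA IHj ?ML.
Qed.
End LatticeEndo.

(** * Idempotents, eigenvalue orders and Roan's products *)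

Section CyclicAction.
Variables (C : numClosedFieldType) (n : nat) (M : 'M[C]_n) (d : nat).
Hypotheses (d_gt0 : (0 < d)%N) (Md1 : M ^+ d = 1).
Variables (I : finType) (k : I -> nat) (P : I -> {poly rat}).
Local Notation pQ := (map_poly (ratr : rat -> algC)).
(* P W stands for the idempotent of the irreducible rational representation  *)
(* W, and k W for the order of the roots of unity at which it is 1.          *)
Hypothesis PE : forall W w, w ^+ d = 1 ->
  (pQ (P W)).[w] = ((k W).-primitive_root w)%:R.
Hypothesis k_inj : injective k.
Hypothesis k_dvd : forall W, (k W %| d)%N.
Hypothesis k_surj : forall m, (m %| d)%N -> exists W, k W = m.
Variable ds : seq nat.
Hypothesis dsP : forall m : nat, m \in ds <->
  exists2 z : C, eigenvalue M z & m.-primitive_root z.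
Local Notation q := (qeval M).

Lemma qeval_sum_idem : \sum_W q (P W) = 1.
Proof.
rewrite -raddf_sum -(rmorph1 q); apply: (qeval_eq d_gt0 Md1) => w wd1.
have [m mw m_dvd] := prim_order_exists d_gt0 wd1.
have [W kW] := k_surj m_dvd.
rewrite raddf_sum rmorph1 hornerC horner_sum (bigD1 W) //= big1 ?addr0 =>
  [|W' neWW'].
  by rewrite PE // kW mw.
rewrite PE //; case: (boolP (_.-primitive_root w)) => // kw.
by case/eqP: neWW'; apply: k_inj; rewrite kW; apply: prim_root_unique kw mw.
Qed.

Lemma qeval_idem W : q (P W) *m q (P W) = q (P W).
Proof.
rewrite -qevalM; apply: (qeval_eq d_gt0 Md1) => w wd1.
by rewrite rmorphM hornerM PE //; case: (_.-primitive_root w);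
  rewrite ?mulr1 ?mulr0.
Qed.

(** r lies in [C] while [P W] is known at roots in algC, so the order of r is found through the
    action on v of the rational polynomials 1 - X^j. *)
Lemma eigenvector_idem W (v : 'rV_n) r : v != 0 -> v *m M = r *: v ->
  v *m q (P W) = v -> (k W).-primitive_root r.
Proof.
move=> v_neq0 vM vP.
have vMX j : v *m M ^+ j = r ^+ j *: v.
  elim: j => [|j IHj]; first by rewrite mulmx1 scale1r.
  by rewrite exprSr [_ * _]/(_ *m _) mulmxA IHj -scalemxAl vM scalerA -exprSr.
have vq0 (f : {poly rat}) : (forall w, w ^+ d = 1 -> (k W).-primitive_root w ->
    (pQ f).[w] = 0) -> v *m q f = 0.
  move=> f0; rewrite -vP -mulmxA -qevalM.
  suff -> : q (P W * f) = 0 by rewrite mulmx0.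
  rewrite -(raddf0 q); apply: (qeval_eq d_gt0 Md1) => w wd1.
  rewrite rmorphM raddf0 hornerM horner0 PE //.
  by case: (boolP (_.-primitive_root w)) => kw; rewrite ?mul0r // f0 ?mulr0.
have rX j : v *m q (1 - 'X^j) = (1 - r ^+ j) *: v.
  by rewrite rmorphB rmorph1 /= qevalXn mulmxBr mulmx1 vMX scalerBl scale1r.
have rk1 : r ^+ k W = 1.
  have /eqP := rX (k W); rewrite vq0 => [|w wd1 kw]; last first.
    by rewrite horner_one_sub_Xn (prim_expr_order kw) subrr.
  by rewrite eq_sym scaler_eq0 (negbTE v_neq0) orbF subr_eq0 eq_sym => /eqP.
have kW_gt0 : (0 < k W)%N := dvdn_gt0 d_gt0 (k_dvd W).
have [m mr m_dvd] := prim_order_exists kW_gt0 rk1.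
have [->|ne_km] := eqVneq (k W) m; first exact: mr.
case/eqP: v_neq0; rewrite -[v]mulmx1.
have -> : 1%:M = q 1 :> 'M[C]_n by exact: (esym (rmorph1 q)).
(* m is a proper divisor of [k W], so 1 - (1 - X^m) t vanishes at the roots of order [k W] and kills
   v; as 1 - X^m kills v too, v = 0. *)
pose t := inv_one_sub_Xn d m.
have -> : q 1 = q (1 - (1 - 'X^m) * t) + q (1 - 'X^m) *m q t.
  by rewrite -qevalM -raddfD /= subrK.
rewrite mulmxDr mulmxA rX (prim_expr_order mr) subrr scale0r mul0mx addr0.
apply: vq0 => w wd1 kw.
rewrite rmorphB rmorph1 rmorphM hornerD hornerN hornerM hornerC
  horner_one_sub_Xn.
rewrite mulrC inv_one_sub_XnP // -(prim_order_dvd kw).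
suff -> : (k W %| m)%N = false by rewrite subrr.
by apply: contra_neqF ne_km => km; apply/eqP; rewrite eqn_dvd km.
Qed.

(** Some projection v P_W(M) of an eigenvector v is nonzero, and it is an eigenvector for the same
    eigenvalue. *)
Lemma eigenvalue_order m : m \in ds -> exists2 W, k W = m & q (P W) != 0.
Proof.
move=> /dsP[r /eigenvalueP[v vM v_neq0] mr].
have [W vW] : exists W, v *m q (P W) != 0.
  apply: contrapT => noW; case/eqP: v_neq0; rewrite -[v]mulmx1.
  have -> : 1%:M = 1 :> 'M[C]_n by [].
  rewrite -qeval_sum_idem mulmx_sumr big1 // => W _.
  by apply: contrapT => /eqP vW; apply: noW; exists W.
have kr : (k W).-primitive_root r.
  apply: (eigenvector_idem vW); last by rewrite -mulmxA qeval_idem.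
  rewrite -mulmxA -{2}(qevalX M) -qevalM mulrC qevalM qevalX mulmxA vM.
  by rewrite -scalemxAl.
exists W; last by apply: contraNneq vW => ->; rewrite mulmx0.
by apply/eqP; rewrite eqn_dvd (prim_order_dvd mr) (prim_order_dvd kr)
  !prim_expr_order ?eqxx.
Qed.

(** A nonzero row of P_W(M) becomes an eigenvector under a matrix commuting with M, which keeps it
    in the image of P_W(M). *)
Lemma qeval_idem_neq0 W : q (P W) != 0 <-> k W \in ds.
Proof.
split=> [PW_neq0|/eigenvalue_order[W' /k_inj->]//].
  have [i Pi] : exists i, row i (q (P W)) != 0.
    apply: contrapT => noi; case/eqP: PW_neq0; apply/row_matrixP=> i.
    by rewrite row0; apply: contrapT => /eqP Pi; apply: noi; exists i.
  have [B [r [BM uB uBM]]] := finite_order_eigenvector d_gt0 Md1 Pi.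
  apply/dsP; exists r; first by apply/eigenvalueP;
    exists (row i (q (P W)) *m B).
  apply: (eigenvector_idem uB uBM).
  have Bq f : B *m q f = q f *m B.
    rewrite /qeval mulmx_sumr mulmx_suml; apply: eq_bigr => j _.
    rewrite -scalemxAr -scalemxAl; congr (_ *: _).
    elim: (j : nat) => [|l IHl]; first by rewrite mulmx1 mul1mx.
    by rewrite exprS -[_ * _]/(_ *m _) mulmxA BM -!mulmxA IHl.
  by rewrite -mulmxA Bq mulmxA -row_mul qeval_idem.
Qed.

(** Only orders in [ds] matter, since P_W(M) = 0 for every other W. *)
Lemma qeval_supported f f' :
    (forall m w, m \in ds -> w ^+ d = 1 -> m.-primitive_root w ->
      (pQ f).[w] = (pQ f').[w]) ->
  q f = q f'.
Proof.
move=> ff'; apply/eqP; rewrite -subr_eq0 -raddfB /= -[q _]mulmx1.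
have -> : 1%:M = 1 :> 'M[C]_n by [].
rewrite -qeval_sum_idem mulmx_sumr; apply/eqP/big1 => W _.
have [->|PW_neq0] := eqVneq (q (P W)) 0; first by rewrite mulmx0.
have k_ds := (qeval_idem_neq0 W).1 PW_neq0.
rewrite -qevalM -(raddf0 q); apply: (qeval_eq d_gt0 Md1) => w wd1.
rewrite rmorphM raddf0 hornerM horner0 PE //.
case: (boolP (_.-primitive_root w)) => kw; rewrite ?mulr0 // mulr1.
by rewrite raddfB hornerD hornerN (ff' (k W)) // subrr.
Qed.

Hypothesis ds_sorted : sorted ltn ds.
Local Notation ds_ i := (nth 0%N ds i).

Let ds_gt0 i : (i < size ds)%N -> (0 < ds_ i)%N.
Proof. by move=> /(mem_nth 0%N)/eigenvalue_order[W <- _];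
  apply: dvdn_gt0 (k_dvd W). Qed.

Let ds_lt i j : (i < j)%N -> (j < size ds)%N -> (ds_ i < ds_ j)%N.
Proof.
move=> lt_ij lt_j; apply: (sorted_ltn_nth ltn_trans 0%N ds_sorted) => //.
by rewrite inE (ltn_trans lt_ij).
Qed.

(** The composite of the maps defining Y: its value at M has image [roan_Y ds i]. *)
Definition roan_poly i : {poly rat} := \prod_(j < i) (1 - 'X^(ds_ j)).

Lemma horner_roan_poly i w : (pQ (roan_poly i)).[w] =
  \prod_(j < i) (1 - w ^+ ds_ j).
Proof.
rewrite rmorph_prod horner_prod; apply: eq_bigr => j _ /=.
exact: horner_one_sub_Xn.
Qed.

Variables (i : nat) (W : I).
Hypotheses (lt_i : (i < size ds)%N) (kW : k W = ds_ i).
Local Notation t := (inv_one_sub_Xn d).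

(** This puts V_(d_i) inside Y: for j < i, d_i does not divide the smaller d_j, so 1 - w^(d_j) is
    invertible at the roots w of order d_i. *)
Lemma roan_poly_idem : exists T, q (P W) = q T *m q (roan_poly i).
Proof.
exists (P W * \prod_(j < i) t (ds_ j)); rewrite -qevalM.
apply: (qeval_eq d_gt0 Md1) => w wd1.
rewrite !rmorphM rmorph_prod !hornerM horner_prod horner_roan_poly -mulrA PE
  // kW.
have [iw|] := boolP (_.-primitive_root w); last by rewrite mul0r.
rewrite -big_split /= big1 ?mulr1 // => j _; rewrite inv_one_sub_XnP //.
rewrite -(prim_order_dvd iw); case: (boolP (_ %| _)%N) => // /dvdn_leq le_ij.
by have := le_ij (ds_gt0 (ltn_trans (ltn_ord j) lt_i)); rewrite leqNgt ds_lt.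
Qed.

Lemma idem_one_sub_Xn : q (P W) *m q (1 - 'X^(ds_ i)) = 0.
Proof.
rewrite -qevalM -(raddf0 q); apply: (qeval_eq d_gt0 Md1) => w wd1.
rewrite rmorphM raddf0 hornerM horner0 PE // kW.
have [iw|] := boolP (_.-primitive_root w); last by rewrite mul0r.
by rewrite horner_one_sub_Xn (prim_expr_order iw) subrr mulr0.
Qed.

(** On Y, 1 - M^(d_i) controls the part outside V_(d_i). At roots of order d_j, both sides vanish
    for j <= i; for j > i, d_j does not divide d_i, so 1 - X^(d_i) is inverted. Other orders are
    discarded by [qeval_supported]. *)
Lemma roan_poly_one_sub_idem : q (roan_poly i) *m q (1 - P W) =
  q (roan_poly i) *m q (1 - 'X^(ds_ i)) *m q (t (ds_ i)).
Proof.
rewrite -!qevalM; apply: qeval_supported => m w /(nthP 0%N)[j lt_j <-] wd1 jw.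
rewrite !rmorphM !hornerM -mulrA.
have [lt_ji|le_ij] := ltnP j i.
  rewrite horner_roan_poly (bigD1 (Ordinal lt_ji)) //= (prim_expr_order jw)
    subrr.
  by rewrite !mul0r.
congr (_ * _); rewrite horner_one_sub_Xn mulrC inv_one_sub_XnP //.
rewrite rmorphB rmorph1 hornerD hornerN hornerC PE // kW.
have [->|ne_ij] := eqVneq i j;
  first by rewrite jw (prim_expr_order jw) eqxx subrr.
have lt_ij : (i < j)%N by rewrite ltn_neqAle ne_ij.
have -> : (ds_ i).-primitive_root w = false.
  apply/negP => iw; have := ds_lt lt_ij lt_j.
  by rewrite (prim_root_unique iw jw) ltnn.
rewrite -(prim_order_dvd jw); case: (boolP (_ %| _)%N) => [/dvdn_leq le_ji|_];
  last by rewrite subr0.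
by have := le_ji (ds_gt0 lt_i); rewrite leqNgt ds_lt.
Qed.
End CyclicAction.

(** * Comparison of the two decompositions *)

Section RoanEndo.
Variables (R : realType) (A : abelian_variety R) (alpha : endo A) (ds : seq
  nat).
Local Notation pi := (@av_pi R A).
Local Notation q := (qeval (rho_a alpha)).

Lemma iter_av_pi m v : iter m alpha (pi v) = pi (v *m rho_a alpha ^+ m).
Proof.
elim: m => [|m IHm]; first by rewrite mulmx1.
by rewrite iterS IHm endoE -mulmxA exprSr.
Qed.

Lemma one_sub_pow_av_pi m v : one_sub_pow alpha m (pi v) =
  pi (v *m q (1 - 'X^m)).
Proof.
rewrite /one_sub_pow iter_av_pi -raddfB; congr pi.
by rewrite raddfB /= rmorph1 qevalXn mulmxBr mulmx1.
Qed.

Lemma roan_Y_av_pi i : roan_Y alpha ds i = range (fun v =>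
  pi (v *m q (roan_poly ds i))).
Proof.
elim: i => [|i IHi] /=.
  apply/seteqP; split=> // x _; have [v <-] := av_pi_surj x.
  by exists v => //; rewrite /roan_poly big_ord0 rmorph1 mulmx1.
have recE : roan_poly ds i.+1 = roan_poly ds i * (1 - 'X^(nth 0%N ds i)).
  by rewrite /roan_poly big_ord_recr.
rewrite IHi recE; apply/seteqP; split=> x.
  move=> [_ [v _ <-] <-]; exists v => //.
  by rewrite one_sub_pow_av_pi qevalM mulmxA.
move=> [v _ <-]; exists (pi (v *m q (roan_poly ds i))); first by exists v.
by rewrite one_sub_pow_av_pi qevalM mulmxA.
Qed.
End RoanEndo.

(** * Isotypical components as images of subspaces *)

Section IsotypicalIm.
Variables (R : realType) (A : abelian_variety R).
Variables (gT : finGroupType) (G : {group gT}) (a : gT).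
Hypothesis hG : G :=: <[a]>%g.
Variable rho : faithful_action A G.
Local Notation pi := (@av_pi R A).
Local Notation M := (rho_a (rho a)).

Lemma rho_a_expg i : rho_a (rho (a ^+ i)%g) = M ^+ i.
Proof.
have Ga : a \in G by rewrite hG cycle_id.
apply: av_pi_mx_inj => v; rewrite -endoE -iter_av_pi.
elim: i => [|i IHi]; first by rewrite expg0 act_endo1.
by rewrite expgS act_endoM ?groupX //= IHi.
Qed.

Lemma rho_a_order : M ^+ #|G| = 1.
Proof.
have a_order : #[a]%g = #|G| by rewrite /order -hG.
rewrite -rho_a_expg -a_order expg_order; apply: av_pi_mx_inj => v.
by rewrite -endoE act_endo1 mulmx1.
Qed.

Lemma rat_rho_qeval p : rat_rho rho (qeval (regular_repr rat G a) p) =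
  qeval M p.
Proof.
have Ga : a \in G by rewrite hG cycle_id.
have rat_rhoE x : x \in G -> rat_rho rho (regular_repr rat G x) = rho_a (rho x).
  move=> Gx; have coefE y : y \in G ->
      gring_row (regular_repr rat G x) 0 (gring_index G y) = (y == x)%:R.
    move=> Gy; rewrite /gring_row rowK gring_indexK ?group1 // mul1g mxE eqxx
      /=.
    by rewrite (can_in_eq (@gring_indexK _ G)).
  rewrite /rat_rho (bigD1 x) //= big1 => [|y /andP[Gy ne_yx]]; rewrite coefE //.
    by rewrite eqxx rmorph1 scale1r addr0.
  by rewrite (negbTE ne_yx) rmorph0 scale0r.
have rat_rhoD : {morph rat_rho rho : e f / e + f}.
  move=> e f; rewrite /rat_rho -big_split; apply: eq_bigr => x _.
  by rewrite linearD mxE rmorphD scalerDl.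
have rat_rhoZ c e : rat_rho rho (c *: e) = ratr c *: rat_rho rho e.
  rewrite /rat_rho scaler_sumr; apply: eq_bigr => x _.
  by rewrite linearZ mxE rmorphM scalerA.
have rat_rho0 : rat_rho rho 0 =
  0 by rewrite -(scale0r 0) rat_rhoZ rmorph0 scale0r.
rewrite /qeval (big_morph _ rat_rhoD rat_rho0); apply: eq_bigr => i _.
rewrite rat_rhoZ -regular_cyclicX // rat_rhoE ?groupX // rho_a_expg.
by rewrite -(fmorph_eq_rat idfun).
Qed.

(** Multiplication by n is bijective on C^g, so n does not affect the image; a suitable n exists by
    [qeval_denominator], so [im] does not fall back on its default. *)
Lemma im_qeval p :
  im rho (qeval (regular_repr rat G a) p) = range (fun v =>
    pi (v *m qeval M p)).
Proof.
pose S := range (fun v => pi (v *m qeval M p)).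
have is_im_uniq S' : is_im rho (qeval (regular_repr rat G a) p) S' -> S' = S.
  move=> [n [f [n_gt0 fE ->]]]; rewrite rat_rho_qeval in fE.
  have n_neq0 : n%:R != 0 :> R[i] by rewrite pnatr_eq0 -lt0n.
  apply/seteqP; split=> x.
    move=> [y _ <-]; have [v <-] := av_pi_surj y; exists (n%:R *: v) => //.
    by rewrite endoE fE -scalemxAl -scalemxAr.
  move=> [v _ <-]; exists (pi (n%:R^-1 *: v)) => //.
  by rewrite endoE fE -scalemxAr -scalemxAl scalerA mulfV // scale1r.
apply: is_im_uniq; apply: xgetPex; exists S.
have [n n_gt0 nL] := @qeval_denominator _ A M p (@rho_a_lattice _ A (rho a)).
have [f fE] : exists f : endo A, rho_a f = n%:R *: qeval M p.
  by apply: endo_of_mx => v vL; rewrite -scalemxAr nL.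
exists n, f; rewrite rat_rho_qeval; split=> //.
have n_neq0 : n%:R != 0 :> R[i] by rewrite pnatr_eq0 -lt0n.
apply/seteqP; split=> x.
  move=> [v _ <-]; exists (pi (n%:R^-1 *: v)) => //.
  by rewrite endoE fE -scalemxAr -scalemxAl scalerA mulfV // scale1r.
move=> [y _ <-]; have [v <-] := av_pi_surj y; exists (n%:R *: v) => //.
by rewrite endoE fE -scalemxAl -scalemxAr.
Qed.
End IsotypicalIm.

(** As j is injective, [reindex] is extension by 0 along j. *)
Lemma reindex_bij (T : zmodType) (I : finType) (n : nat) (j : 'I_n -> I)
    (B : 'I_n -> set T) (D : I -> set T) :
    injective j -> (forall i, D (j i) = B i) ->
    (forall W, (forall i, W <> j i) -> D W = [set 0]) ->
  let reindex (b : {ffun 'I_n -> T}) := [ffun W => \sum_(i | j i == W) b i] in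
  set_bij [set b : {ffun 'I_n -> T} | forall i, B i (b i)]
          [set x : {ffun I -> T} | forall W, D W (x W)] reindex /\
  forall b : {ffun 'I_n -> T}, \sum_W reindex b W = \sum_i b i.
Proof.
move=> j_inj DB D0 reindex.
have reindexE b i : reindex b (j i) = b i.
  rewrite ffunE (eq_bigl (pred1 i)) ?big_pred1_eq // => i'.
  by rewrite /= (inj_eq j_inj).
have reindex0 b W : (forall i, W <> j i) -> reindex b W = 0.
  by move=> Wj; rewrite ffunE big1 // => i /eqP/esym/Wj.
have WP W : (exists i, W = j i) \/ (forall i, W <> j i).
  have [[i Wi]|noi] := pselect (exists i, W = j i); [by left; exists i | right].
  by move=> i Wi; apply: noi; exists i.
split; last first.
  move=> b; rewrite (eq_bigr (fun W => \sum_(i | j i == W) b i)) => [|W _];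
    last by rewrite ffunE.
  rewrite (exchange_big_dep xpredT) //=; apply: eq_bigr => i _.
  by rewrite (big_pred1 (j i)) // => W; rewrite eq_sym.
split.
- move=> b /= bB W; have [[i ->]|Wj] := WP W; first by rewrite reindexE DB.
  by rewrite reindex0 // D0.
- move=> b b' _ _ bb'; apply/ffunP=> i.
  by rewrite -(reindexE b) -(reindexE b') bb'.
move=> x /= xD; exists [ffun i => x (j i)].
  by move=> i; rewrite ffunE -DB.
apply/ffunP=> W; have [[i ->]|Wj] := WP W; first by rewrite reindexE ffunE.
by rewrite reindex0 //; have := xD W; rewrite D0.
Qed.

Theorem theorem3p1 (R : realType) (A : abelian_variety R)
    (gT : finGroupType) (G : {group gT}) (a : gT) (d : nat)
    (hG : G :=: <[a]>%g) (hd : #|G| = d)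
    (rho : faithful_action A G)
    (sG : irrType rat G)
    (ds : seq nat) (ds_sorted : sorted ltn ds)
    (dsP : forall m : nat, m \in ds <->
       exists2 z : R[i], eigenvalue (rho_a (rho a)) z & m.-primitive_root z) :
  exists j : 'I_(size ds) -> sG,
    [/\ forall i : 'I_(size ds),
          unique (fun W : sG => isotypical rho W = roan_B (rho a) ds i) (j i),
        injective j,
        forall W : sG, (forall i : 'I_(size ds), W <> j i) ->
          isotypical rho W = [set 0]
      & let reindex (b : {ffun 'I_(size ds) -> points A}) :=
          [ffun W : sG => \sum_(i : 'I_(size ds) | j i == W) b i] in
        set_bij
          [set b : {ffun 'I_(size ds) -> points A} |
             forall i : 'I_(size ds), roan_B (rho a) ds i (b i)]
          [set x : {ffun sG -> points A} | forall W, isotypical rho W (x W)]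
          reindex /\
        forall b : {ffun 'I_(size ds) -> points A},
          \sum_(W : sG) reindex b W = \sum_(i : 'I_(size ds)) b i].
Proof.
have d_gt0 : (0 < #|G|)%N by exact: cardG_gt0.
have [k [P [eP PE k_inj k_dvd k_surj]]] := Wedderburn_cyclic hG sG.
have Md1 := rho_a_order hG rho.
set M := rho_a (rho a) in dsP Md1.
pose pi := @av_pi R A.
(* The image of an idempotent, written as a kernel to match [connected_component_av_pi]. *)
have isoE W : isotypical rho W = pi @` [set v | v *m qeval M (1 - P W) = 0].
  rewrite /isotypical eP im_qeval //; apply/seteqP; split=> x.
    move=> [v _ <-]; exists (v *m qeval M (P W)) => //=.
    rewrite raddfB /= rmorph1 -mulmxA mulmxBr mulmx1.
    by rewrite (qeval_idem d_gt0 Md1 PE) subrr mulmx0.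
  move=> [v /= vQ <-]; exists v => //; congr av_pi; move/eqP: vQ.
  by rewrite raddfB /= rmorph1 mulmxBr mulmx1 subr_eq0 => /eqP.
have ML v : v \in av_lattice A ->
  v *m M \in av_lattice A by exact: rho_a_lattice.
have roanE (i : 'I_(size ds)) W : k W = nth 0%N ds i ->
    roan_B (rho a) ds i = pi @` [set v | v *m qeval M (1 - P W) = 0].
  move=> kW; have [n1 n1_gt0 n1L] := qeval_denominator (1 - P W) ML.
  have [n2 n2_gt0 n2L] := qeval_denominator (inv_one_sub_Xn #|G| (nth 0%N ds
    i)) ML.
  (* n1 clears the denominators of 1 - P_W(M), n2 those of the inverse of 1 - M^(d_i). *)
  apply: (@connected_component_av_pi _ _ _ _ (n1 * n2)%N).
  - by rewrite muln_gt0 n1_gt0.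
  - by move=> v vL; rewrite mulnC natrM -scalerA scaler_nat rpredMn // n1L.
  - move=> v; rewrite raddfB /= rmorph1 mulmxBr mulmx1 => /eqP;
    rewrite subr_eq0 => /eqP vP.
    split.
      rewrite roan_Y_av_pi.
      have [T PT] := roan_poly_idem d_gt0 Md1 PE k_inj k_dvd k_surj dsP
        ds_sorted (ltn_ord i) kW.
      by exists (v *m qeval M T) => //; rewrite -mulmxA -PT -vP.
    rewrite /= one_sub_pow_av_pi vP -mulmxA.
    by rewrite (idem_one_sub_Xn d_gt0 Md1 PE kW) mulmx0 raddf0.
  move=> x [] /=; rewrite roan_Y_av_pi => -[v _ <-].
  rewrite one_sub_pow_av_pi => /av_pi_eq0 vL.
  exists (v *m qeval M (roan_poly ds i)) => //.
  rewrite -mulmxA (roan_poly_one_sub_idem d_gt0 Md1 PE k_inj k_dvd k_surj dsP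
    ds_sorted (ltn_ord i) kW).
  by rewrite !mulmxA natrM -scalerA scaler_nat rpredMn // n2L.
have ex_j (i : 'I_(size ds)) : exists W, k W = nth 0%N ds i.
  have [W kW _] := eigenvalue_order d_gt0 Md1 PE k_inj k_dvd k_surj dsP
    (mem_nth 0%N (ltn_ord i)).
  by exists W.
have [j jP] := choice ex_j.
have j_inj : injective j.
  move=> i i' jii'; apply: val_inj; apply/eqP.
  have ds_uniq : uniq ds by move: ds_sorted;
    rewrite ltn_sorted_uniq_leq => /andP[].
  by rewrite -(nth_uniq 0%N (ltn_ord i) (ltn_ord i') ds_uniq) -!jP jii'.
have isoB i : isotypical rho (j i) = roan_B (rho a) ds i.
  by rewrite isoE (roanE i (j i)).
have iso0 W : (forall i, W <> j i) -> isotypical rho W = [set 0].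
  move=> Wj; have PW0 : qeval M (P W) = 0.
    apply/eqP; apply: contrapT => /negP.
    move=> /(qeval_idem_neq0 d_gt0 Md1 PE k_inj k_dvd k_surj dsP)/(nthP 0%N)[l
      lt_l kW].
    by apply: (Wj (Ordinal lt_l)); apply: k_inj; rewrite jP.
  rewrite isoE raddfB /= rmorph1 PW0 subr0; apply/seteqP; split=> x /=.
    by move=> [v]; rewrite mulmx1 => -> <-; exact: raddf0.
  by move=> ->; exists 0; rewrite ?mul0mx //; exact: raddf0.
exists j; split=> //; last exact: (reindex_bij j_inj isoB iso0).
(* For m = d_i <> [k W], equality would put V_m inside V_(k W) + L. Applying n (1 - P_W(M)), which
   is n on V_m, sends every real line of V_m into L, so V_m = 0, although m is the order of an
   eigenvalue. *)
move=> i; split=> // W isoW; apply: (k_inj); apply/eqP; apply: contraT => ne_k.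
have : qeval M (P (j i)) != 0.
  by apply/(qeval_idem_neq0 d_gt0 Md1 PE k_inj k_dvd k_surj dsP);
    rewrite jP mem_nth.
have P_orth : qeval M (P (j i)) *m qeval M (P W) = 0.
  rewrite -qevalM -(raddf0 (qeval M)); apply: (qeval_eq d_gt0 Md1) => w wd1.
  rewrite rmorphM raddf0 hornerM horner0 !PE //.
  case: (boolP (_.-primitive_root w)) => [iw|_]; last by rewrite mul0r.
  case: (boolP (_.-primitive_root w)) => [iw'|_]; last by rewrite mulr0.
  by rewrite (prim_root_unique iw iw') eqxx in ne_k.
case/eqP; apply/row_matrixP=> l; rewrite row0; set v := row l _.
have vP : v *m qeval M (P (j i)) =
  v by rewrite -row_mul (qeval_idem d_gt0 Md1 PE).
have vQ : v *m qeval M (1 - P W) = v.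
  by rewrite raddfB /= rmorph1 mulmxBr mulmx1 -{2}vP -mulmxA P_orth mulmx0
    subr0.
have [n n_gt0 nL] := qeval_denominator (1 - P W) ML.
have n_neq0 : n%:R != 0 :> R[i] by rewrite pnatr_eq0 -lt0n.
apply: (scalerI n_neq0); rewrite scaler0.
apply: (lattice_line (@av_latticeP _ A)) => t.
have : isotypical rho (j i) (pi (t%:C *: v)).
  rewrite isoE; exists (t%:C *: v) => //=.
  by rewrite -scalemxAl raddfB /= rmorph1 mulmxBr mulmx1 vP subrr scaler0.
rewrite isoB -isoW isoE => -[u /= uQ /av_pi_eq utL].
have := nL _ utL; rewrite mulmxBl uQ sub0r -scalemxAl vQ scalerN rpredN.
by rewrite scalerA mulrC -scalerA.
Qed.
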